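(* Let $n\geq 3$ be an integer. The exponents $\bar{\varphi}_1,\ldots,\bar{\varphi}_n$ are algebraically independent: there is no nonzero polynomial $R\in\mathbb{R}[X_1,\ldots,X_n]$ such that $R\big(\bar{\varphi}_1(\boldsymbol{u}),\ldots,\bar{\varphi}_n(\boldsymbol{u})\big)=0$ for every unit vector $\boldsymbol{u}\in\mathbb{R}^{n+1}$.
   Context: For $\boldsymbol{u}=(u_0,\ldots,u_n)\in\mathbb{R}^{n+1}$ with Euclidean norm $\|\boldsymbol{u}\|_2=1$ and a real $Q\geq 1$, let $\mathcal{C}_{\boldsymbol{u}}(Q)=\{\boldsymbol{x}\in\mathbb{R}^{n+1} : \|\boldsymbol{x}\|_2\leq 1,\ |\boldsymbol{x}\cdot\boldsymbol{u}|\leq Q^{-1}\}$, and for $1\leq d\leq n+1$ let $\lambda_d(\mathcal{C}_{\boldsymbol{u}}(Q))$ be the $d$-th successive minimum of this convex body with respect to the lattice $\mathbb{Z}^{n+1}$. For $q\geq 0$ set $L_{\boldsymbol{u},d}(q)=\log\lambda_d(\mathcal{C}_{\boldsymbol{u}}(e^q))$, and define $\bar{\varphi}_d(\boldsymbol{u})=\limsup_{q\to\infty} L_{\boldsymbol{u},d}(q)/q$. *)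

(* Defs.v *)
From mathcomp Require Export all_boot all_order all_algebra.
From mathcomp Require Export all_classical all_reals all_analysis.
(* The notations of [mpoly] clash with those of MathComp-Analysis. *)
From mathcomp Require Export (canonicals, coercions) mpoly.
Export numFieldNormedType.Exports.
Export Order.TTheory GRing.Theory Num.Theory.

Set Implicit Arguments.
Unset Strict Implicit.
Unset Printing Implicit Defensive.

Local Open Scope classical_set_scope.
Local Open Scope ring_scope.

Definition dotprod (R : realType) (m : nat) (x y : 'rV[R]_m) : R :=
  \sum_(i < m) x 0 i * y 0 i.

(* The library norm [`|x|] on ['rV[R]_m] is the sup norm. *)
Definition norm2 (R : realType) (m : nat) (x : 'rV[R]_m) : R :=
  Num.sqrt (\sum_(i < m) x 0 i ^+ 2).

Definition cbody (R : realType) (m : nat) (u : 'rV[R]_m) (Q : R) :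
    set 'rV[R]_m :=
  [set x | norm2 x <= 1 /\ `|dotprod x u| <= Q^-1].

Definition int_lattice (R : realType) (m : nat) : set 'rV[R]_m :=
  [set x | forall i, x 0 i \is a Num.int].

(* [successive_min d C] is the infimum of the l > 0 such that l C contains d
   linearly independent points (the rows of [M]) of the integer lattice. *)
Definition successive_min (R : realType) (m d : nat) (C : set 'rV[R]_m) : R :=
  inf [set l : R | 0 < l /\
    exists M : 'M[R]_(d, m),
      row_free M /\
      forall i : 'I_d,
        int_lattice (row i M) /\ [set l *: y | y in C] (row i M)].

Definition Lmap (R : realType) (m : nat) (u : 'rV[R]_m) (d : nat) (q : R) : R :=
  ln (successive_min d (cbody u (expR q))).

(* For a unit vector [u], [1 <= d <= m] and [Q >= 1], the body [cbody u Q] lies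
   between the balls of radii [Q^-1] and [1]; hence [0 <= Lmap u d q <= q] for
   [q >= 0], so that the upper limit is finite and [fine] loses nothing. *)
Definition phi_bar (R : realType) (m : nat) (d : nat) (u : 'rV[R]_m) : R :=
  fine (limf_esup (fun q : R => (Lmap u d q / q)%:E) (pinfty_nbhs R)).

(* Main.v *)
(** For a nondecreasing superlinear sequence of natural numbers a_i, let
    x_0, ..., x_n be the standard basis of Z^(n+1) and
    x_(i+n+1) = x_i - 2^(a_(i+n+1) - a_(i+1)) x_(i+1).  Then |x_i| is at most
    about 2^(a_i), consecutive (n+1)-tuples are linearly independent, and by
    compactness some unit vector u has w_i = x_i . u >= 0 for all i.  The
    recurrence w_i = 2^(a_(i+n+1) - a_(i+1)) w_(i+1) + w_(i+n+1) makes w_i at most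
    about 2^(-S_i), where S_i = a_(i+1) + ... + a_(i+n).  Hence the successive
    minima of C_u(e^q) are bounded above by the trajectories of the x_i, and
    below because an integral determinant that does not vanish is at least 1 in
    absolute value.  The d-th upper exponent is then the upper limit of
    a_(i+d) / (a_(i+d) + S_i).

    Let the sequence a be mostly constant, with jumps by factors r_1, ..., r_n
    growing fast enough and arranged so that the upper limit for d is attained
    where a jump by r_d is surrounded by constant stretches.  The d-th exponent
    is then 1 / (n + r_1) if d = 1, and r_d / ((n-d+2) r_d + d - 1) if d > 1.  It
    depends injectively on r_d alone, and r_1, ..., r_n can be chosen one after
    the other to avoid the zeros of a nonzero polynomial. *)

Require Import Defs.
From mathcomp Require Import perm zify ring lra.

Set Implicit Arguments.
Unset Strict Implicit.
Unset Printing Implicit Defensive.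

(** * Heights with prescribed jumps *)

(* The jumps of the heights, coded by letters: the ratio of two consecutive
   heights is 1 at the letter 0, and the letter e > 0 stands for the e-th of the
   m + 1 available ratios. Blocks of length 2m succeed one another; the block of
   index b mod m reads 0^(m-1) (b+2) 0^(m-1-b) 1^(b+1). *)
Definition letter (m i : nat) : nat :=
  let h := i %/ m in let s := i %% m in let b := (h./2 %% m)%N in
  if s == m.-1 then (if odd h then 1 else b.+2)
  else if odd h && (m - b <= s.+1) then 1 else 0.

Lemma letterE m h s : s < m -> letter m (m * h + s) =
  if s == m.-1 then (if odd h then 1 else (h./2 %% m).+2)
  else if odd h && (m - h./2 %% m <= s.+1) then 1 else 0.
Proof.
move=> sm; have m0 : 0 < m by exact: leq_ltn_trans sm.
by rewrite /letter mulnC modnMDl divnMDl // (divn_small sm) addn0 modn_small.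
Qed.

Lemma letter_split m i : 0 < m -> exists h s, s < m /\ i = m * h + s.
Proof.
by move=> m0; exists (i %/ m), (i %% m); rewrite ltn_mod m0 mulnC -divn_eq.
Qed.

Lemma letter_run m i : 0 < m -> exists2 j, i <= j < i + m & 0 < letter m j.
Proof.
move=> m0; have [h [s [sm ->]]] := letter_split i m0.
exists (m * h + m.-1); first by lia.
by rewrite letterE ?eqxx; [case: odd | lia].
Qed.

Lemma letter_le m i : 0 < m -> letter m i <= m.+1.
Proof.
move=> m0; rewrite /letter; have := ltn_pmod (i %/ m)./2 m0.
by do !case: ifP => _ //; lia.
Qed.

(** A letter b+2 ends the even half of its block, and the odd half has only m-1-b zeros before its
    ones. So after a large ratio the heights cannot stay constant for long. *)
Lemma letter_after m i : 0 < m -> 1 < letter m i ->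
  exists2 j, i < j <= i + (m.+2 - letter m i) & 0 < letter m j.
Proof.
move=> m0; have [h [s [sm ->]]] := letter_split i m0.
rewrite letterE //; case: eqP => [es|_]; last by case: ifP.
case: ifP => // hodd _; have bm := ltn_pmod h./2 m0.
have e : (h.+1)./2 = h./2 by lia.
exists (m * h.+1 + (m - h./2 %% m).-1); first by rewrite mulnS; lia.
rewrite letterE; last by lia.
have o : odd h.+1 by rewrite /= hodd.
rewrite o e; case: eqP => // _.
by rewrite prednK ?leqnn //; lia.
Qed.

Lemma letter_before m i k : 0 < m -> 1 < letter m i -> k.+1 < m ->
  k < i /\ letter m (i - k.+1) = 0.
Proof.
move=> m0; have [h [s [sm ->]]] := letter_split i m0.
rewrite letterE //; case: eqP => [es|_]; last by case: ifP.
case: ifP => // hodd _ km; split; first by lia.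
have -> : m * h + s - k.+1 = m * h + (s - k.+1) by lia.
rewrite letterE; last by lia.
by rewrite hodd /=; case: eqP => //; lia.
Qed.

Lemma letter_occurs m e N : 0 < m -> 1 < e <= m.+1 ->
  exists i, [/\ N <= i, letter m i = e,
   (forall k, k.+1 < m -> k < i /\ letter m (i - k.+1) = 0) &
   forall k, k < m.+1 - e -> letter m (i + k.+1) = 0].
Proof.
(* Even half of the block of index m * N + (e - 2), which is e - 2 mod m; the summand m * N pushes
   it past N. *)
move=> m0 em; pose h := (2 * (m * N + (e - 2))).
have h2 : h./2 %% m = e - 2.
  have -> : h./2 = N * m + (e - 2) by lia.
  by rewrite modnMDl modn_small //; lia.
have ho : odd h = false by lia.
have le : letter m (m * h + m.-1) = e.
  by rewrite letterE ?eqxx ?ho ?h2; lia.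
exists (m * h + m.-1); split => //.
- by rewrite /h; nia.
- by move=> k km; apply: letter_before => //; lia.
- move=> k ke; have -> : m * h + m.-1 + k.+1 = m * h.+1 + k by rewrite mulnS; lia.
  have e1 : (h.+1)./2 = h./2 by lia.
  rewrite letterE; last by lia.
  have o : odd h.+1 by rewrite /= ho.
  by rewrite o e1 h2; case: eqP => [|_]; [lia|case: leqP => //; lia].
Qed.

Definition height (m : nat) (r : nat -> nat) (i : nat) : nat :=
  \prod_(j < i) (if letter m j is e.+1 then r e else 1).

Lemma leq_sum_const (F : nat -> nat) (A p q : nat) :
  (forall k, p <= k < q -> A <= F k) -> (q - p) * A <= \sum_(p <= k < q) F k.
Proof. by move=> AF; rewrite -sum_nat_const_nat !big_nat; apply: leq_sum. Qed.

Lemma eq_sum_const (F : nat -> nat) (A p q : nat) :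
  (forall k, p <= k < q -> F k = A) -> \sum_(p <= k < q) F k = (q - p) * A.
Proof. by move=> AF; rewrite -sum_nat_const_nat !big_nat; apply: eq_bigr. Qed.

(** For d = c + 1 the terms from index c on are at least a_(i+d); the last one is kept apart because
    a jump inside the window enlarges it. *)
Lemma sum_window (F : nat -> nat) (c m : nat) : c <= m ->
  \sum_(k < m.+1) F k =
  \sum_(0 <= k < c) F k + \sum_(c <= k < m) F k + F m.
Proof.
move=> cm; rewrite -(big_mkord xpredT F) big_nat_recr //=.
by rewrite (@big_cat_nat _ _ _ c).
Qed.

Section Height.
Variables (m : nat) (r : nat -> nat).
Hypotheses (m_gt0 : 0 < m) (r0 : 2 <= r 0)
  (rS : forall i, i < m -> i.+1 * r i <= r i.+1).
Local Notation a := (height m r).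
Local Notation S i := (\sum_(k < m.+1) a (i + k.+1)).

Lemma heightS i : a i.+1 = a i * (if letter m i is e.+1 then r e else 1).
Proof. by rewrite /height big_ord_recr. Qed.

Lemma ratio_leq i j : i <= j <= m -> r i <= r j.
Proof.
move=> /andP[]; elim: j => [|j IHj]; first by rewrite leqn0 => /eqP ->.
rewrite leq_eqVlt => /orP[/eqP -> //|ij jm].
by apply: leq_trans (IHj ij (ltnW jm)) _; apply: leq_trans (rS jm); apply: leq_pmull.
Qed.

Lemma ratio_ge2 e : e <= m -> 2 <= r e.
Proof. by move=> em; apply: leq_trans r0 _; apply: ratio_leq. Qed.

Lemma heightS_ge i : a i <= a i.+1.
Proof.
rewrite heightS; have := letter_le i m_gt0; case: letter => [|e] em; first by rewrite muln1.
by apply: leq_pmulr; apply: ltn_trans (ratio_ge2 em).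
Qed.

Lemma height_leq i j : i <= j -> a i <= a j.
Proof. exact: (homo_leq leqnn leq_trans heightS_ge). Qed.

Lemma height_gt0 i : 0 < a i.
Proof. by apply: leq_trans (height_leq (leq0n i)); rewrite /height big_ord0. Qed.

Lemma heightS_jump i : 0 < letter m i -> r 0 * a i <= a i.+1.
Proof.
rewrite heightS; have := letter_le i m_gt0; case: letter => [|e] //= em _.
by rewrite mulnC leq_mul2l ratio_leq ?orbT.
Qed.

Lemma height_jump i j k : 0 < letter m k -> i <= k < j -> r 0 * a i <= a j.
Proof.
move=> lk /andP[ik kj]; apply: leq_trans (height_leq kj).
by apply: leq_trans (heightS_jump lk); rewrite leq_mul2l height_leq ?orbT.
Qed.

Lemma height_run i : r 0 * a i <= a (i + m).
Proof. by have [j ij lj] := letter_run i m_gt0; apply: height_jump lj ij. Qed.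

Lemma height_flat i k : (forall j, j < k -> letter m (i + j) = 0) ->
  a (i + k) = a i.
Proof.
elim: k => [|k IHk] H; first by rewrite addn0.
rewrite addnS heightS H // muln1 IHk // => j jk; apply: H; exact: ltnW.
Qed.

Lemma height_exp h : 2 ^ h <= a (m * h).
Proof.
elim: h => [|h IHh]; first by rewrite muln0 height_gt0.
by rewrite expnS mulnSr; apply: leq_trans (height_run _); apply: leq_mul.
Qed.

Lemma height_superlinear K : exists N, forall i, N <= i -> K * i <= a i.
Proof.
exists (2 * m * (4 * m * K).+1) => i iN.
pose h := i %/ (2 * m).
have hN : 4 * m * K < h by rewrite leq_divRL //; lia.
have hi : i < 2 * m * h.+1 by rewrite mulnC ltn_ceil //; lia.
have hh : 2 * m * h <= i by rewrite mulnC leq_trunc_div.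
(* The heights at least double every m steps, so a_i >= 2^(2h) >= h^2, quadratic against a bound
   linear in h. *)
have ah : h * h <= a i.
  apply: (@leq_trans (a (m * (2 * h)))); last by apply: height_leq; lia.
  apply: leq_trans (height_exp _); rewrite mul2n -addnn expnD.
  by apply: leq_mul; apply: ltnW; apply: ltn_expl.
apply: leq_trans ah; apply: (@leq_trans (K * (2 * m * h.+1))).
  by rewrite leq_mul2l (ltnW hi) orbT.
apply: (@leq_trans ((4 * m * K) * h)); last by rewrite leq_mul2r (ltnW hN) orbT.
nia.
Qed.

(* In the notation of the header, with n = m + 1 and r_(c+1) written [r c]: the
   case d = 1; [window_ge] is the case d = c + 1. *)
Lemma window0_ge i : (m + r 0) * a i.+1 <= S i.
Proof.
rewrite (@sum_window (fun k => a (i + k.+1)) 0) // big_geq // add0n mulnDl.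
apply: leq_add.
  rewrite -{1}(subn0 m); apply: leq_sum_const => k _; apply: height_leq; lia.
by rewrite addnS -addSn; apply: height_run.
Qed.

Lemma window_ge c i : 0 < c <= m ->
  ((m - c).+1 * r c + c) * a (i + c.+1) <= r c * S i.
Proof.
move=> /andP[c0 cm]; rewrite (@sum_window (fun k => a (i + k.+1)) c) //.
set A := a (i + c.+1).
have hi : (m - c) * A <= \sum_(c <= k < m) a (i + k.+1).
  by apply: leq_sum_const => k kc; apply: height_leq; lia.
have rc : c * r c.-1 <= r c by have := @rS c.-1; rewrite prednK //; apply.
have rc1 : 2 <= r c.-1 by apply: ratio_ge2; lia.
(* A jump in the last m - c steps makes the last height at least 2A, so the sum is at least (m - c +
   2) A, which suffices since c <= [r c]. Otherwise these heights all equal A, and only c * A has to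
   be compared with the first c terms. *)
have [/hasP [j]|/hasPn H] := boolP (has (fun j => 0 < letter m j) (iota (i + c.+1) (m - c))).
  rewrite mem_iota => jlt lj.
  have : r 0 * A <= a (i + m.+1) by apply: height_jump lj _; lia.
  by nia.
have flat : forall j, j < m - c -> letter m (i + c.+1 + j) = 0.
  move=> j jlt; apply/eqP; rewrite -leqn0 leqNgt; apply: H.
  by rewrite mem_iota; lia.
have Am : a (i + m.+1) = A.
  have -> : i + m.+1 = i + c.+1 + (m - c) by lia.
  exact: height_flat.
rewrite Am; suff : c * A <= r c * \sum_(0 <= k < c) a (i + k.+1) by nia.
set T := \sum_(_ <= _ < _) _; have AT : a (i + c) <= T.
  rewrite /T; case: (c) c0 => // c' _; rewrite big_nat_recr //=; exact: leq_addl.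
have AE : A = a (i + c) * (if letter m (i + c) is e.+1 then r e else 1).
  by rewrite /A addnS heightS.
have := letter_le (i + c) m_gt0; case le: (letter m (i + c)) AE => [|e] AE em.
  by nia.
(* The jump into A: a smaller ratio is absorbed by the growth condition [rS]; a larger one would
   force another jump within m - c steps; for [r c] itself the c heights before the jump are
   equal. *)
have [ec|ec|ec] := ltngtP e c.
- have re : r e <= r c.-1 by apply: ratio_leq; lia.
  apply: leq_trans (leq_mul rc AT).
  by rewrite AE mulnCA mulnC leq_mul2r leq_mul2l re !orbT.
- exfalso; have [|j jlt lj] := @letter_after m (i + c) m_gt0; first by rewrite le; lia.
  rewrite le in jlt; have := flat (j - (i + c.+1)).
  have -> : i + c.+1 + (j - (i + c.+1)) = j by lia.
  by move=> /(_ _) lj0; move: lj; rewrite lj0 //; lia.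
- suff cT : c * a (i + c) <= T by rewrite AE ec mulnA mulnC leq_mul2l cT orbT.
  rewrite /T; have -> : c * a (i + c) = (c - 0) * a (i + c) by rewrite subn0.
  apply: leq_sum_const => k kc.
  have -> : i + c = i + k.+1 + (c - k.+1) by lia.
  rewrite height_flat // => j jlt.
  have [||_ ] := @letter_before m (i + c) (c - k.+1 - j).-1 m_gt0; [by rewrite le; lia|lia|].
  by move=> <-; congr letter; lia.
Qed.

Lemma window0_eq N : exists2 i, N <= i & (m + r 0) * a i.+1 = S i.
Proof.
(* Odd half of a block with b = 0: it reads 0^(m-1) 1, so the window has m equal heights followed by
   one jump by [r 0]. *)
pose h := (2 * (m * N)).+1.
have h2 : h./2 %% m = 0.
  have -> : h./2 = N * m by lia.
  exact: modnMl.
have ho : odd h by lia.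
have hN : N < m * h by rewrite /h; nia.
have lt k : k < m.-1 -> letter m (m * h + k) = 0.
  move=> km; rewrite letterE ?ho ?h2; last by lia.
  by case: eqP => [|_]; [lia|case: leqP => //; lia].
have ll : letter m (m * h + m.-1) = 1 by rewrite letterE ?eqxx ?ho //; lia.
exists (m * h).-1; first by lia.
have fold k : (m * h).-1 + k.+1 = m * h + k by lia.
rewrite (@sum_window (fun k => a ((m * h).-1 + k.+1)) 0) // big_geq // add0n prednK; last by lia.
rewrite (@eq_sum_const _ (a (m * h))) => [|k km].
  have e : m * h + m = (m * h + m.-1).+1 by lia.
  by rewrite fold e heightS ll height_flat //; nia.
rewrite fold; apply: height_flat => j jk; apply: lt; lia.
Qed.

Lemma window_eq c N : 0 < c <= m ->
  exists2 i, N <= i & ((m - c).+1 * r c + c) * a (i + c.+1) = r c * S i.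
Proof.
move=> /andP[c0 cm]; have [|i [Ni li before after]] := @letter_occurs m c.+1 (N + m.+1) m_gt0.
  by lia.
(* The window is placed so that its first c heights precede the jump by [r c] at i and the other m -
   c + 1 follow it. *)
exists (i - c); first by lia.
rewrite (@sum_window (fun k => a (i - c + k.+1)) c) //.
set A := a (i - c + c.+1).
have AE : A = a i * r c.
  by rewrite /A addnS subnK ?heightS ?li //; lia.
have lo : \sum_(0 <= k < c) a (i - c + k.+1) = c * a i.
  have -> : c * a i = (c - 0) * a i by rewrite subn0.
  apply: eq_sum_const => k kc.
  rewrite -[RHS](_ : a (i - c + k.+1 + (c - k.+1)) = _); last by congr height; lia.
  symmetry; apply: height_flat => j jlt.
  have [|_] := before (c - k.+1 - j).-1; first by lia.
  by move=> <-; congr letter; lia.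
have flat k : c <= k <= m -> a (i - c + k.+1) = A.
  move=> kc; have -> : i - c + k.+1 = i - c + c.+1 + (k - c) by lia.
  apply: height_flat => j jlt.
  have : j < m.+1 - c.+1 by lia.
  by move=> /after <-; congr letter; lia.
have hi : \sum_(c <= k < m) a (i - c + k.+1) = (m - c) * A.
  by apply: eq_sum_const => k kc; apply: flat; lia.
by rewrite lo hi flat ?cm ?leqnn // AE; nia.
Qed.

End Height.

Local Open Scope ring_scope.

(** * Zeros of polynomials *)

(** A monomial is determined by its degree in the last variable and its truncation [rst] to the
    others, so each coefficient of P reappears unmixed inside [mpoly.muni P]. *)
Lemma muni_neq0 (R : nzRingType) (n : nat) (P : mpoly.mpoly n.+1 R) :
  P != 0 -> mpoly.muni P != 0.
Proof.
move=> P0.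
have [m0 m0P] : exists m0, m0 \in mpoly.msupp P.
  case: (mpoly.msupp P) (mpoly.msupp_eq0 P) => [|m0 s _].
    by rewrite eqxx => /esym; rewrite (negbTE P0).
  by exists m0; rewrite inE eqxx.
have coef0 : mpoly.mcoeff m0 P != 0 by rewrite -mpoly.mcoeff_msupp.
apply/negP => /eqP uP0; move/negP: coef0; apply; apply/eqP.
pose rst (m : mpoly.multinom n.+1) : mpoly.multinom n :=
  mpoly.Multinom [tuple m (widen_ord (leqnSn n) i) | i < n].
have := congr1 (fun p : {poly mpoly.mpoly n R} => mpoly.mcoeff (rst m0) p`_(m0 ord_max)) uP0.
rewrite /= mpoly.muniE coef0 mpoly.mcoeff0 coef_sum raddf_sum /= => H.
rewrite -[RHS]H (bigD1_seq m0 m0P (mpoly.msupp_uniq _)) /=.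
rewrite -[LHS]addr0; congr (_ + _).
  by rewrite !coefZ coefXn eqxx mulr1 mpoly.mcoeffZ mpoly.mcoeffX eqxx mulr1.
symmetry; apply: big1 => m mm0.
rewrite !coefZ coefXn; case: eqP => [em|_]; last by rewrite mulr0 raddf0.
rewrite mulr1 mpoly.mcoeffZ mpoly.mcoeffX; case: eqP => [er|_]; last by rewrite mulr0.
case/eqP: mm0; apply/mpoly.mnmP => i.
case: (unliftP ord_max i) => [j ->|->]; last by rewrite em.
have := congr1 (fun m : mpoly.multinom n => m j) er.
rewrite /rst !mpoly.mnmE /=.
suff -> : widen_ord (leqnSn n) j = lift ord_max j by [].
by apply/val_inj => /=; rewrite /bump leqNgt ltn_ord.
Qed.

Lemma meval_muni (R : comNzRingType) (n : nat) (v : 'I_n.+1 -> R)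
    (P : mpoly.mpoly n.+1 R) :
  mpoly.meval v P =
  (map_poly (mpoly.meval (fun i => v (widen_ord (leqnSn n) i)))
     (mpoly.muni P)).[v ord_max].
Proof.
rewrite mpoly.muniE rmorph_sum /= horner_sum mpoly.mevalE.
apply: eq_bigr => m _.
rewrite -mul_polyC rmorphM /= map_polyC /= map_polyXn hornerM hornerC.
rewrite hornerXn mpoly.mevalZ mpoly.mevalX big_ord_recr /= -mulrA.
by congr (_ * (_ * _)); apply: eq_bigr => i _; rewrite mpoly.mnmE.
Qed.

(** The values of f at [size p] consecutive integers are distinct, too many to be all roots of p. *)
Lemma nonroot_ge (R : realFieldType) (f : nat -> R) (p : {poly R}) (B : nat) :
  injective f -> p != 0 -> exists2 r, (B <= r)%N & p.[f r] != 0.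
Proof.
move=> finj p0.
have [/hasP [r]|/hasPn H] := boolP (has (fun r => p.[f r] != 0) (iota B (size p))).
  by rewrite mem_iota => /andP[Br _] ?; exists r.
exfalso.
have := @max_poly_roots _ p (map f (iota B (size p))) p0.
rewrite size_map size_iota ltnn => max; suff: false by []; apply: max.
- by apply/allP => _ /mapP[r /H /negPn ? ->].
- by rewrite map_inj_uniq // iota_uniq.
Qed.

(** Induction on the number of variables: the first parameters keep the leading coefficient in the
    last variable nonzero, which leaves a nonzero univariate polynomial for the last parameter. The
    bounds [b] and [B] carry the growth conditions on the ratios. *)
Lemma meval_neq0_exists (R : realFieldType) (n : nat) (P : mpoly.mpoly n R)
    (f : nat -> nat -> R) (b : nat) (B : nat -> nat -> nat) :
  (forall i, injective (f i)) -> P != 0 ->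
  exists r : nat -> nat, [/\ (0 < n)%N -> (b <= r 0)%N,
    forall i, (i.+1 < n)%N -> (B i (r i) <= r i.+1)%N &
    mpoly.meval (fun i : 'I_n => f i (r i)) P != 0].
Proof.
move=> finj; elim: n P => [|n IHn] P P0.
  exists (fun=> 0%N); split => //.
  rewrite (mpoly.nvar0_mpolyC P) mpoly.mevalC; apply: contraNneq P0 => e0.
  by rewrite (mpoly.nvar0_mpolyC P) e0 mpoly.mpolyC0.
have /IHn [r [rb rB rq]] : lead_coef (mpoly.muni P) != 0.
  by rewrite lead_coef_eq0 muni_neq0.
set h := mpoly.meval _ in rq.
have p0 : map_poly h (mpoly.muni P) != 0.
  apply: contraNneq rq => /(congr1 (fun p : {poly R} => p`_(size (mpoly.muni P)).-1)).
  by rewrite coef_map coef0 => e; apply/eqP; exact: e.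
have [s sB ps] := nonroot_ge (if n is k.+1 then B k (r k) else b) (finj n) p0.
exists (fun i => if i == n then s else r i); split.
- by move=> _; case: (n) sB rb => [|k] //= _ -> .
- move=> i; rewrite ltnS => ilt; rewrite (ltn_eqF ilt).
  case: eqP => [e|ne]; first by rewrite -e in sB.
  by apply: rB; rewrite ltn_neqAle; apply/andP; split => //; apply/eqP.
- rewrite meval_muni /= eqxx; congr (_.[_] != _): ps; apply: eq_map_poly => q.
  by apply: mpoly.meval_eq => i; rewrite /= ltn_eqF.
Qed.

(** * Successive minima *)

Section Norm2.
Variables (R : realType) (m : nat).
Implicit Types v u : 'rV[R]_m.

Lemma norm2_ge0 v : 0 <= norm2 v. Proof. exact: sqrtr_ge0. Qed.

Lemma coord_le_norm2 v k : `|v 0 k| <= norm2 v.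
Proof.
rewrite -sqrtr_sqr ler_wsqrtr // (bigD1 k) //= lerDl.
by apply: sumr_ge0 => i _; apply: sqr_ge0.
Qed.

Lemma norm2_le v (B : R) :
  0 <= B -> (forall k, `|v 0 k| <= B) -> norm2 v <= m%:R * B.
Proof.
move=> B0 vB.
rewrite -(@ger0_norm _ (m%:R * B)) ?mulr_ge0 // -sqrtr_sqr ler_wsqrtr //.
apply: (@le_trans _ _ (\sum_(i < m) B ^+ 2)).
  by apply: ler_sum => i _; rewrite -real_normK ?num_real // lerXn2r ?nnegrE.
rewrite sumr_const card_ord exprMn -[B ^+ 2 *+ _]mulr_natl ler_wpM2r ?sqr_ge0 //.
by rewrite -natrX ler_nat; nia.
Qed.

Lemma norm2Z (l : R) v : norm2 (l *: v) = `|l| * norm2 v.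
Proof.
rewrite /norm2 -sqrtr_sqr -sqrtrM ?sqr_ge0 // mulr_sumr.
by congr (Num.sqrt _); apply: eq_bigr => i _; rewrite mxE exprMn.
Qed.

Lemma norm2_eq0 v : norm2 v = 0 -> v = 0.
Proof.
move=> v0; apply/rowP => k; rewrite mxE; apply/eqP.
by rewrite -normr_le0 -v0 coord_le_norm2.
Qed.

Lemma dotprodZl (l : R) v u : dotprod (l *: v) u = l * dotprod v u.
Proof. by rewrite /dotprod mulr_sumr; apply: eq_bigr => i _; rewrite mxE mulrA. Qed.

Lemma dotprodZr (l : R) v u : dotprod v (l *: u) = l * dotprod v u.
Proof. by rewrite /dotprod mulr_sumr; apply: eq_bigr => i _; rewrite mxE mulrCA. Qed.

Lemma dotprodBl v v' u : dotprod (v - v') u = dotprod v u - dotprod v' u.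
Proof. by rewrite /dotprod -sumrB; apply: eq_bigr => i _; rewrite !mxE mulrBl. Qed.

Lemma unit_coord_ge u : norm2 u = 1 -> exists k, 1 <= m%:R * `|u 0 k|.
Proof.
move=> u1; have [k0 _] : exists k0 : 'I_m, true.
  case: (pickP (fun _ : 'I_m => true)) => [k0 _|H]; first by exists k0.
  by have := oner_neq0 R; rewrite -u1 /norm2 big1 ?sqrtr0 ?eqxx // => k; have := H k.
case: (Order.TotalTheory.arg_maxP (fun k => `|u 0 k|) (erefl : xpredT k0)) => k _ kmax.
by exists k; rewrite -[leLHS]u1; apply: norm2_le => // j; apply: kmax.
Qed.
End Norm2.

Section Det.
Variables (R : realType) (m : nat).

(** All m! terms of the Leibniz expansion obey the same bound. The column factors [mu] allow a
    single column to be much smaller than the others. *)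
Lemma leibniz_le (W : 'M[R]_m) (l mu : 'I_m -> R) :
  (forall i j, `|W i j| <= l i * mu j) ->
  `|\det W| <= m`!%:R * ((\prod_i l i) * \prod_j mu j).
Proof.
move=> Wl; rewrite /determinant; apply: le_trans (ler_norm_sum _ _ _) _.
have -> : m`!%:R * ((\prod_i l i) * \prod_j mu j) =
    \sum_(s : {perm 'I_m}) ((\prod_i l i) * \prod_j mu j).
  by rewrite sumr_const card_Sn mulr_natl.
apply: ler_sum => s _; rewrite normrM normrX normrN1 expr1n mul1r normr_prod.
rewrite [\prod_j mu j](reindex_inj (@perm_inj _ s)) /= -big_split /=.
by apply: ler_prod => i _; rewrite normr_ge0 Wl.
Qed.

(* Replacing the column [k] of [V] by the products with [u] multiplies the
   determinant by [u 0 k]. *)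
Lemma det_dotprod_le (V : 'M[R]_m) (u : 'rV[R]_m) (l : 'I_m -> R) (e : R) :
  norm2 u = 1 ->
  (forall i, norm2 (row i V) <= l i /\ `|dotprod (row i V) u| <= e * l i) ->
  `|\det V| <= (m * m`!)%:R * (e * \prod_i l i).
Proof.
move=> u1 Vl; have [k uk] := unit_coord_ge u1.
pose W := \matrix_(i, j) (if j == k then dotprod (row i V) u else V i j).
have detW : \det W = u 0 k * \det V.
  rewrite (expand_det_col _ k).
  have -> : u 0 k * \det V = (\adj V *m (V *m u^T)) k 0.
    by rewrite mulmxA mul_adj_mx mul_scalar_mx !mxE mulrC.
  rewrite mxE; apply: eq_bigr => i _; rewrite mulrC !mxE eqxx; congr (_ * _).
    rewrite /cofactor; congr (_ * \det _); apply/matrixP => p q.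
    by rewrite !mxE eq_sym (negbTE (neq_lift _ _)).
  by apply: eq_bigr => j _; rewrite !mxE.
have := @leibniz_le W l (fun j => if j == k then e else 1).
rewrite detW -big_mkcond big_pred1_eq normrM => /(_ _) Wle.
have {}Wle : `|u 0 k| * `|\det V| <= m`!%:R * ((\prod_i l i) * e).
  apply: Wle => i j; rewrite mxE; have [Vl1 Vl2] := Vl i.
  case: eqP => _; first by rewrite mulrC.
  by rewrite mulr1; apply: le_trans Vl1; have := coord_le_norm2 (row i V) j; rewrite mxE.
apply: (@le_trans _ _ (m%:R * `|u 0 k| * `|\det V|)); first by rewrite ler_peMl.
by rewrite -mulrA natrM -mulrA ler_wpM2l // (mulrC e).
Qed.

Lemma int_det_ge1 (V : 'M[R]_m) :
  (forall i j, V i j \is a Num.int) -> \det V != 0 -> 1 <= `|\det V|.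
Proof.
move=> Vint d0; apply: norm_intr_ge1 => //; apply: rpred_sum => s _.
by rewrite rpredMsign; apply: rpred_prod.
Qed.

End Det.

Section SuccessiveMin.
Variables (R : realType) (m : nat).
Implicit Types u : 'rV[R]_m.

Lemma scaled_cbodyP u (Q l : R) (v : 'rV[R]_m) : 0 < l ->
  ([set l *: y | y in cbody u Q] v)%classic <->
  (norm2 v <= l /\ `|dotprod v u| <= Q^-1 * l).
Proof.
move=> l0; split.
  move=> [y [y1 yQ] <-]; rewrite norm2Z dotprodZl normrM gtr0_norm // [Q^-1 * l]mulrC.
  by rewrite !ler_pM2l // ger_pMr.
move=> [v1 vQ]; exists (l^-1 *: v); last by rewrite scalerA mulfV ?scale1r ?gt_eqF.
split; first by rewrite norm2Z gtr0_norm ?invr_gt0 // mulrC ler_pdivrMr // mul1r.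
by rewrite dotprodZl normrM gtr0_norm ?invr_gt0 // mulrC ler_pdivrMr.
Qed.

Definition min_admissible d u (Q l : R) (M : 'M[R]_(d, m)) : Prop :=
  [/\ row_free M, forall i j, M i j \is a Num.int &
    forall i, norm2 (row i M) <= l /\ `|dotprod (row i M) u| <= Q^-1 * l].

Lemma successive_minE d u Q :
  successive_min d (cbody u Q) =
  inf [set l : R | 0 < l /\ exists M : 'M[R]_(d, m), min_admissible u Q l M]%classic.
Proof.
congr inf; apply/seteqP; split => l /= [l0 [M]].
  move=> [Mf HM]; split => //; exists M; split => // i.
    by move=> j; have [/(_ j)] := HM i; rewrite mxE.
  by have [_ Hi] := HM i; apply/(scaled_cbodyP u Q (row i M) l0).
move=> [Mf Mint HM]; split => //; exists M; split => // i; split.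
  by move=> j; rewrite mxE.
by apply/(scaled_cbodyP u Q (row i M) l0).
Qed.

Lemma successive_min_le d u Q l (M : 'M[R]_(d, m)) :
  0 < l -> min_admissible u Q l M -> successive_min d (cbody u Q) <= l.
Proof.
move=> l0 HM; rewrite successive_minE; apply: ge_inf; last by split => //; exists M.
by exists 0 => x [/ltW].
Qed.

(** The admissible [M] guarantees that the infimum is over a nonempty set, hence not a default
    value. *)
Lemma successive_min_ge d u Q l l' (M : 'M[R]_(d, m)) :
  0 < l -> min_admissible u Q l M ->
  (forall l (M : 'M[R]_(d, m)), 0 < l -> min_admissible u Q l M -> l' <= l) ->
  l' <= successive_min d (cbody u Q).
Proof.
move=> l0 HM H; rewrite successive_minE; apply: lb_le_inf.
  by exists l; split => //; exists M.
by move=> x [x0 [N]]; apply: H.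
Qed.

(** Otherwise d independent rows would lie in the span of fewer than d coordinate vectors. *)
Lemma coef_outside d (Y : 'M[R]_(d, m)) (D : {set 'I_m}) :
  (#|D| < d)%N -> row_free Y -> exists i k, k \notin D /\ Y i k != 0.
Proof.
move=> Dd Yf; apply/not_existsP => H; move: Dd; rewrite ltnNge => /negP; apply.
rewrite -(eqP Yf).
have YD : (Y <= \sum_(k in D) <<delta_mx 0 k : 'rV[R]_m>>)%MS.
  apply/row_subP => i; rewrite [row i Y]row_sum_delta; apply: summx_sub => k _.
  have [kD|kD] := boolP (k \in D).
    by apply: scalemx_sub; apply: (sumsmx_sup k) => //; rewrite genmxE.
  rewrite mxE; have [|/negP/negPn/eqP ->] := pselect (Y i k != 0); last by rewrite scale0r sub0mx.
  by move=> ik; case: (H i); exists k.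
apply: leq_trans (mxrankS YD) _.
rewrite -sum1_card; elim/big_rec2: _ => [|k p A _ Ap]; first by rewrite mxrank0.
by apply: leq_trans (mxrank_adds_leqif _ _) _; rewrite leq_add // genmxE rank_leq_row.
Qed.

(** Steinitz exchange: as the coordinate of z on row k is nonzero, that row is recovered from z and
    the other rows. *)
Lemma replace_row_unit (X : 'M[R]_m) (z : 'rV[R]_m) k :
  X \in unitmx -> (z *m invmx X) 0 k != 0 ->
  (\matrix_i (if i == k then z else row i X)) \in unitmx.
Proof.
move=> Xu; set V := \matrix_i _; set y := z *m invmx X => yk.
have Vrow j : j != k -> (row j X <= V)%MS.
  by move=> jk; have := row_sub j V; rewrite rowK (negbTE jk).
have zy : z = y *m X by rewrite mulmxKV.
rewrite -row_full_unit -sub1mx; have : (1%:M <= X)%MS by rewrite sub1mx row_full_unit.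
move=> /submx_trans; apply; apply/row_subP => j.
have [->|] := eqVneq j k; last exact: Vrow.
have -> : row k X = (y 0 k)^-1 *: (z - \sum_(j | j != k) y 0 j *: row j X).
  rewrite zy mulmx_sum_row (bigD1 k) //= addrK scalerA mulVf ?scale1r //.
apply: scalemx_sub; apply: addmx_sub.
  by have := row_sub k V; rewrite rowK eqxx.
rewrite eqmx_opp; apply: summx_sub => i ik; apply: scalemx_sub; exact: Vrow.
Qed.

(* Some row of [M] has a nonzero coordinate on a row of [X] outside [D]; replacing
   that row of [X] by it keeps the determinant nonzero, hence at least 1. *)
Lemma exchange_le d u (e l : R) (M : 'M[R]_(d, m)) (X : 'M[R]_m)
    (D : {set 'I_m}) (b : 'I_m -> R) :
  norm2 u = 1 -> X \in unitmx -> (forall i j, X i j \is a Num.int) ->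
  (forall i, norm2 (row i X) <= b i /\ `|dotprod (row i X) u| <= e * b i) ->
  (#|D| < d)%N -> min_admissible u e^-1 l M ->
  exists2 k, k \notin D &
    1 <= (m * m`!)%:R * (e * (l * \prod_(i | i != k) b i)).
Proof.
move=> u1 Xu Xint Xb Dd [Mf Mint Ml].
have [|i [k [kD ik]]] := coef_outside (Y := M *m invmx X) Dd.
  by rewrite /row_free mxrankMfree // row_free_unit unitmx_inv.
exists k => //; pose V := \matrix_j (if j == k then row i M else row j X).
have Vu : V \in unitmx.
  by apply: replace_row_unit => //; rewrite -row_mul mxE.
have V1 : 1 <= `|\det V|.
  apply: int_det_ge1; last by rewrite -unitfE -unitmxE.
  by move=> p q; rewrite mxE; case: ifP => _; rewrite mxE.
have := @det_dotprod_le _ _ V u (fun j => if j == k then l else b j) e u1.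
rewrite (bigD1 k) //= eqxx (eq_bigr b) => [|j /negbTE -> //] Vle.
apply: le_trans V1 (Vle _) => j; rewrite rowK; case: eqP => // _.
by have := Ml i; rewrite invrK.
Qed.

End SuccessiveMin.

(** * The unit vector attached to a sequence of heights *)

Lemma continuous_sumr (R : realType) (T : topologicalType) (I : Type)
    (r : seq I) (f : I -> T -> R) :
  (forall k, continuous (f k)) -> continuous (fun t => \sum_(k <- r) f k t).
Proof.
move=> fc; elim: r => [|k r IHr] t.
  rewrite /continuous_at big_nil; under eq_cvg do rewrite big_nil.
  exact: cvg_cst.
rewrite /continuous_at big_cons; under eq_cvg do rewrite big_cons.
by apply: cvgD; [exact: fc | exact: IHr].
Qed.

Section Points.
Variables (R : realType) (n : nat) (a : nat -> nat).
Hypotheses (n_gt0 : (0 < n)%N) (a_leq : forall i j, (i <= j)%N -> (a i <= a j)%N).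

Definition quotient i : R := 2 ^+ (a (i + n.+1) - a i.+1).

(** Carrying the n+1 consecutive points x_i, ..., x_(i+n) turns the recurrence of order n+1 into a
    structural recursion. *)
Fixpoint frame (i : nat) : nat -> 'rV[R]_n.+1 :=
  if i is j.+1 then
    fun k => if k == n then frame j 0 - quotient j *: frame j 1 else frame j k.+1
  else fun k => delta_mx 0 (inord k).

Definition point i := frame i 0.

Local Notation x := point.
Local Notation c := quotient.
Local Notation S i := (\sum_(k < n) a (i + k.+1))%N.

Lemma frameE i k : (k <= n)%N -> frame i k = x (i + k)%N.
Proof.
elim: k i => [|k IHk] i kn; first by rewrite addn0.
by rewrite addnS -addSn -IHk ?(ltnW kn) //= ltn_eqF.
Qed.

Lemma point_init k : (k <= n)%N -> x k = delta_mx 0 (inord k).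
Proof. by move=> kn; rewrite -[k in LHS]add0n -frameE. Qed.

Lemma pointS i : x (i + n.+1) = x i - c i *: x i.+1.
Proof.
by rewrite addnS -addSn -frameE //= eqxx [frame i 1]frameE // addn1.
Qed.

Lemma point_int i k : x i 0 k \is a Num.int.
Proof.
suff : forall j k, frame i j 0 k \is a Num.int by exact.
elim: i => [|i IHi] j {}k /=; first by rewrite !mxE; case: (_ && _); rewrite ?rpred0 ?rpred1.
case: ifP => _ //; rewrite !mxE rpredB // rpredM // rpredX //.
exact: natr_int.
Qed.

(** Both terms of the recurrence obey the same bound, so each step costs at most a factor 2; hence
    the extra i in the exponent, negligible against a_i. *)
Lemma point_le i k : `|x i 0 k| <= 2 ^+ (i + a i).
Proof.
have [N] := ubnP i; elim: N i => // N IHN i.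
have [iN|] := leqP i n.
  rewrite point_init // mxE => _; apply: (@le_trans _ _ 1).
    by case: (_ && _); rewrite ?normr0 ?normr1.
  by rewrite exprn_ege1 // ler1n.
move=> ni iN; have e : i = (i - n.+1 + n.+1)%N by lia.
move: (i - n.+1)%N e => j e; rewrite {}e {ni} in iN *.
rewrite pointS !mxE; apply: le_trans (ler_normB _ _) _.
rewrite normrM (ger0_norm (exprn_ge0 _ _)) //.
apply: (@le_trans _ _ (2 ^+ (j.+1 + a (j + n.+1)) + 2 ^+ (j.+1 + a (j + n.+1)))).
  apply: lerD.
    apply: le_trans (IHN _ _) _; first by lia.
    rewrite ler_eXn2l ?ltr1n // leq_add // a_leq //; lia.
  apply: (@le_trans _ _ (c j * 2 ^+ (j.+1 + a j.+1))).
    by rewrite ler_wpM2l ?exprn_ge0 // IHN; lia.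
  rewrite -exprD ler_eXn2l ?ltr1n //.
  have := @a_leq j.+1 (j + n.+1); lia.
rewrite -mulr2n -[leLHS]mulr_natl -exprS ler_eXn2l ?ltr1n //; lia.
Qed.

Definition block i : 'M[R]_n.+1 := \matrix_(k < n.+1) x (i + k).

Lemma block_unit i : block i \in unitmx.
Proof.
rewrite -row_full_unit -sub1mx; elim: i => [|i IHi].
  apply/row_subP => k; rewrite rowE mulmx1.
  have := row_sub k (block 0); rewrite rowK add0n point_init; last by rewrite -ltnS.
  by rewrite inord_val.
apply: submx_trans IHi _; apply/row_subP => k; rewrite rowK.
have sub j : (j <= n)%N -> (x (i.+1 + j) <= block i.+1)%MS.
  move=> jn; have := row_sub (inord j) (block i.+1).
  by rewrite rowK inordK.
case: (val k) (ltn_ord k) => [|j] kn; last by rewrite addnS -addSn sub //; lia.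
have -> : x (i + 0) = x (i.+1 + n) + c i *: x (i.+1 + 0).
  by rewrite !addn0 addSnnS pointS subrK.
by apply: addmx_sub; rewrite ?scalemx_sub ?sub.
Qed.

Lemma exists_nonneg_upto N : exists2 u : 'rV[R]_n.+1, norm2 u = 1 &
  forall i, (i <= N + n)%N -> 0 <= dotprod (x i) u.
Proof.
(* v has product 1 with x_N, ..., x_(N+n); the recurrence read backwards, x_i = x_(i+n+1) + c_i
   x_(i+1), carries nonnegativity down to x_0. *)
pose v : 'rV[R]_n.+1 := (invmx (block N) *m const_mx 1)^T.
have vN k : (k <= n)%N -> dotprod (x (N + k)) v = 1.
  move=> kn; have : block N *m v^T = const_mx 1 by rewrite trmxK mulKVmx ?block_unit.
  move=> /(congr1 (fun M : 'cV[R]_n.+1 => M (inord k) 0)); rewrite !mxE => <-.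
  by apply: eq_bigr => j _; rewrite !mxE inordK.
have v0 : 0 < norm2 v.
  rewrite lt_def norm2_ge0 andbT; apply/eqP => /norm2_eq0 v0.
  have := vN 0%N isT; rewrite v0 /dotprod big1 => [/esym/eqP|j _]; last by rewrite mxE mulr0.
  by rewrite oner_eq0.
have vpos i : (i <= N + n)%N -> 0 <= dotprod (x i) v.
  move=> iN; have [j] := ubnP (N + n - i); elim: j i iN => // j IHj i iN ij.
  have [Ni|iN'] := leqP N i; first by rewrite -(subnKC Ni) vN ?ler01 //; lia.
  have -> : x i = x (i + n.+1) - (- c i) *: x i.+1 by rewrite pointS scaleNr opprK subrK.
  rewrite dotprodBl dotprodZl mulNr opprK addr_ge0 ?mulr_ge0 ?exprn_ge0 // IHj //; lia.
exists ((norm2 v)^-1 *: v).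
  by rewrite norm2Z gtr0_norm ?invr_gt0 // mulVf // gt_eqF.
by move=> i /vpos vi; rewrite dotprodZr mulr_ge0 // invr_ge0 ltW.
Qed.

Lemma continuous_dotprod (v : 'rV[R]_n.+1) :
  continuous (fun u : 'rV[R]_n.+1 => dotprod v u).
Proof.
apply: continuous_sumr => k u.
apply: (@continuous_cvg _ _ _ (nbhs u) (nbhs_filter u)
  (fun w : 'rV[R]_n.+1 => w 0 k) (fun t : R => v 0 k * t)) => [t|].
  exact: mulrl_continuous.
exact: coord_continuous.
Qed.

Lemma continuous_norm2 : continuous (fun u : 'rV[R]_n.+1 => norm2 u).
Proof.
move=> u; rewrite /continuous_at /norm2.
apply: (@continuous_cvg _ _ _ (nbhs u) (nbhs_filter u) _ Num.sqrt _ (@sqrt_continuous R _)).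
apply: (@continuous_sumr _ _ _ _ (fun k (u : 'rV[R]_n.+1) => u 0 k ^+ 2)) => k {}u.
apply: (@continuous_cvg _ _ _ (nbhs u) (nbhs_filter u)
  (fun w : 'rV[R]_n.+1 => w 0 k) (fun t : R => t ^+ 2)) => [t|].
  exact: exprn_continuous.
exact: coord_continuous.
Qed.

Lemma exists_nonneg : exists2 u : 'rV[R]_n.+1, norm2 u = 1 &
  forall i, 0 <= dotprod (x i) u.
Proof.
pose K := [set u : 'rV[R]_n.+1 | norm2 u = 1]%classic.
have [u_ u_1 u_pos] : exists2 u_ : nat -> 'rV[R]_n.+1, forall N, norm2 (u_ N) = 1 &
    forall N i, (i <= N + n)%N -> 0 <= dotprod (x i) (u_ N).
  have /choice [u_ Hu] : forall N, exists u, norm2 u = 1 /\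
      forall i, (i <= N + n)%N -> 0 <= dotprod (x i) u.
    by move=> N; have [u] := exists_nonneg_upto N; exists u.
  by exists u_ => N; have [] := Hu N.
have cK : compact K.
  apply: bounded_closed_compact.
    exists 1; split; first by rewrite num_real.
    move=> M M1 u /= u1; rewrite [leLHS]/Num.Def.normr /= mx_normrE; apply: bigmax_le => [|[i k] _ /=].
      exact: le_trans (ltW M1).
    by rewrite (ord1 i); apply: le_trans (coord_le_norm2 _ _) _; rewrite u1 ltW.
  have -> : K = ((fun u : 'rV[R]_n.+1 => norm2 u) @^-1` [set 1])%classic by [].
  apply: closed_comp; last exact: closed_eq.
  by move=> u _; apply: continuous_norm2.
have uK : (u_ @ \oo)%classic K by exists 0%N => // N _; apply: u_1.
(* A cluster point on the sphere: each closed half-space x_i . u >= 0 contains all [u_ N] with N >=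
   i, hence the cluster point. *)
have [u [/= u1 uc]] := cK _ (fmap_proper_filter _ _) uK.
exists u => // i.
pose D := [set u : 'rV[R]_n.+1 | 0 <= dotprod (x i) u]%classic.
have cD : closed D.
  have -> : D = ((fun u : 'rV[R]_n.+1 => dotprod (x i) u) @^-1` [set t | 0 <= t])%classic by [].
  apply: closed_comp; last exact: closed_ge.
  by move=> v _; apply: continuous_dotprod.
suff : D u by [].
rewrite (closure_id D).1 //; move: uc; rewrite clusterE; apply.
by exists i => // N /= iN; apply: u_pos; lia.
Qed.

Lemma window_shift i : (S i.+1 + a i.+1 = S i + a (i + n.+1))%N.
Proof.
case: (n) n_gt0 => // k _; rewrite big_ord_recr [in RHS]big_ord_recl /=.
have -> : (\sum_(j < k) a (i.+1 + j.+1) = \sum_(j < k) a (i + (bump 0 j).+1))%N.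
  by apply: eq_bigr => j _; congr a; rewrite /bump /=; lia.
have -> : (i.+1 + k.+1 = i + k.+2)%N by lia.
by rewrite addn1 addnAC [(_ + a i.+1)%N]addnC.
Qed.

(** The product w_i 2^(S_i) is nonincreasing: w_(i+n+1) >= 0 gives c_i w_(i+1) <= w_i, and c_i =
    2^(S_(i+1) - S_i). *)
Lemma dotprod_point_le (u : 'rV[R]_n.+1) i : norm2 u = 1 ->
  (forall i, 0 <= dotprod (x i) u) ->
  dotprod (x i) u <= 2 ^+ (S 0) * (2 ^+ (S i))^-1.
Proof.
move=> u1 upos; rewrite ler_pdivlMr ?exprn_gt0 //.
elim: i => [|i IHi].
  rewrite ler_piMl ?exprn_ge0 // point_init //.
  rewrite /dotprod (bigD1 (inord 0)) //= big1 => [|k k0].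
    rewrite !mxE !eqxx mul1r addr0 -u1; apply: le_trans (ler_norm _) _.
    exact: coord_le_norm2.
  by rewrite mxE (negbTE k0) andbF mul0r.
have SS : (S i.+1 = S i + (a (i + n.+1) - a i.+1))%N.
  have le : (a i.+1 <= a (i + n.+1))%N by apply: a_leq; lia.
  by have := window_shift i; lia.
apply: le_trans IHi; rewrite SS exprD mulrA mulrAC.
rewrite ler_wpM2r ?exprn_ge0 // mulrC -subr_ge0.
by have := upos (i + n.+1)%N; rewrite pointS dotprodBl dotprodZl.
Qed.

End Points.

(** * Upper exponents *)

Lemma limf_esup_pinfty_eq (R : realType) (f : R -> R) (l : R) :
  (forall e, 0 < e -> exists q0, forall q, q0 <= q -> f q <= l + e) ->
  (forall e q0, 0 < e -> exists2 q, q0 <= q & l <= f q + e) ->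
  limf_esup (fun q => (f q)%:E) (pinfty_nbhs R) = l%:E.
Proof.
move=> fle fge; apply/eqP; rewrite eq_le limf_esupE; apply/andP; split.
  apply/lee_addgt0Pr => e e0; have [q0 fq0] := fle e e0.
  apply: (@le_trans _ _ (ereal_sup ((fun q => (f q)%:E) @` [set q | q0 < q])%classic)).
    apply: ereal_inf_lbound; exists [set q | q0 < q]%classic => //.
    by exists q0; split => //; rewrite num_real.
  apply: ge_ereal_sup => _ [q /= q0q <-].
  by rewrite -EFinD lee_fin fq0 // ltW.
apply: le_ereal_inf_tmp => _ [V [M [_ MV]] <-].
apply/lee_addgt0Pr => e e0; have [q Mq lq] := fge e (M + 1) e0.
have Vq : V q by apply: MV; apply: lt_le_trans Mq; rewrite ltrDl.
apply: (@le_trans _ _ ((f q)%:E + e%:E)%E); first by rewrite -EFinD lee_fin.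
by rewrite leeD2r //; apply: ereal_sup_ubound; exists q.
Qed.

Section Exponent.
Variables (R : realType) (n : nat) (a : nat -> nat).
Hypotheses (n_gt0 : (0 < n)%N) (a_leq : forall i j, (i <= j)%N -> (a i <= a j)%N).
Hypothesis a_superlinear :
  forall K, exists N, forall i, (N <= i)%N -> (K * i <= a i)%N.
Variable u : 'rV[R]_n.+1.
Local Notation x := (point R n a).
Hypotheses (u1 : norm2 u = 1) (u_ge0 : forall i, 0 <= dotprod (x i) u).
Local Notation S i := (\sum_(k < n) a (i + k.+1))%N.

(** One constant that serves both for the norms and for the products with u. *)
Let K : R := n.+1%:R * 2 ^+ S 0.

Lemma K_ge1 : 1 <= K.
Proof. by rewrite mulr_ege1 ?ler1n // exprn_ege1 // ler1n. Qed.

Lemma window_leq i j : (i <= j)%N -> (S i <= S j)%N.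
Proof. by move=> ij; apply: leq_sum => k _; apply: a_leq; rewrite leq_add2r. Qed.

Lemma norm2_point i : norm2 (x i) <= K * 2 ^+ (i + a i).
Proof.
apply: le_trans (norm2_le _ (@point_le R n a n_gt0 a_leq i)) _; first by rewrite exprn_ge0.
by rewrite ler_wpM2r ?exprn_ge0 // ler_peMr // exprn_ege1 // ler1n.
Qed.

Lemma dotprod_point i : `|dotprod (x i) u| <= K * (2 ^+ S i)^-1.
Proof.
rewrite ger0_norm //; apply: le_trans (dotprod_point_le n_gt0 a_leq i u1 u_ge0) _.
by rewrite ler_wpM2r ?invr_ge0 ?exprn_ge0 // ler_peMl ?exprn_ge0 // ler1n.
Qed.

Lemma linear_small (C e : R) : 0 < e ->
  exists N, forall i, (N <= i)%N -> C * i.+1%:R <= e * (a i)%:R.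
Proof.
move=> e0; pose k := (Num.truncn (`|C| / e)).+1.
have Ck : `|C| <= e * k%:R by rewrite -ler_pdivrMl // mulrC ltW // truncnS_gt.
have [N aN] := a_superlinear (2 * k); exists N.+1 => i Ni.
apply: (@le_trans _ _ (`|C| * i.+1%:R)); first by rewrite ler_wpM2r // ler_norm.
apply: (@le_trans _ _ (e * k%:R * i.+1%:R)); first by rewrite ler_wpM2r.
rewrite -mulrA (ler_wpM2l (ltW e0)) // -natrM ler_nat.
apply: leq_trans (aN i (ltnW Ni)); nia.
Qed.

(** The points are x_(i+1), ..., x_(i+d): the last governs the norms, the first the products with
    u. *)
Lemma points_admissible d i q : (d <= n)%N ->
  exists M : 'M[R]_(d, n.+1),
  min_admissible u (expR q)
    (K * 2 ^+ (i + d) * Num.max (2 ^+ a (i + d)) (expR q * (2 ^+ S i.+1)^-1)) M.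
Proof.
move=> dn; exists (pid_mx d *m block R n a i.+1).
have rowM (k : 'I_d) : row k (pid_mx d *m block R n a i.+1) = x (i.+1 + k).
  have kn : (k < n.+1)%N by apply: leq_trans (ltn_ord k) (leqW dn).
  rewrite row_mul [row k _](_ : _ = delta_mx 0 (Ordinal kn)).
    by rewrite -rowE rowK.
  by apply/rowP => l; rewrite !mxE eqxx /= -val_eqE eq_sym ltn_ord andbT.
split.
- rewrite /row_free mxrankMfree ?row_free_unit ?block_unit //.
  by rewrite rank_pid_mx // leqW.
- move=> k l; have -> : (pid_mx d *m block R n a i.+1) k l =
    row k (pid_mx d *m block R n a i.+1) 0 l by rewrite [RHS]mxE.
  by rewrite rowM point_int.
move=> k; rewrite rowM; have kd := ltn_ord k; split.
  apply: le_trans (norm2_point _) _; rewrite -mulrA ler_wpM2l ?(le_trans ler01 K_ge1) //.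
  apply: (@le_trans _ _ (2 ^+ (i + d) * 2 ^+ a (i + d))).
    rewrite -exprD ler_eXn2l ?ltr1n // leq_add ?a_leq //; lia.
  by rewrite ler_wpM2l ?exprn_ge0 // le_max lexx.
apply: le_trans (dotprod_point _) _.
rewrite mulrCA -[leRHS]mulrA ler_wpM2l ?(le_trans ler01 K_ge1) //.
apply: (@le_trans _ _ ((2 ^+ S i.+1)^-1)).
  by rewrite lef_pV2 ?posrE ?exprn_gt0 // ler_eXn2l ?ltr1n // window_leq //; lia.
rewrite mulrCA ler_pdivlMl ?expR_gt0 // .
apply: (@le_trans _ _ (Num.max (2 ^+ a (i + d)) (expR q * (2 ^+ S i.+1)^-1))).
  by rewrite le_max lexx orbT.
by rewrite ler_peMl ?exprn_ege1 ?ler1n // le_max exprn_ge0.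
Qed.

Lemma Lmap_le d i q : (d <= n)%N ->
  Lmap u d q <= ln K + (i + d)%:R * ln 2 +
    Num.max ((a (i + d))%:R * ln 2) (q - (S i.+1)%:R * ln 2).
Proof.
move=> dn; have [M HM] := points_admissible i q dn.
set l := (_ * _ * _) in HM.
have l1 : 1 <= l.
  rewrite /l mulr_ege1 // ?mulr_ege1 ?K_ge1 // ?exprn_ege1 ?ler1n //.
  by rewrite le_max exprn_ege1 ?ler1n.
have l0 : 0 < l := lt_le_trans ltr01 l1.
apply: (@le_trans _ _ (ln l)).
  (* [ln] is 0 on nonpositive arguments, so this case needs only l >= 1. *)
  rewrite /Lmap; have [s0|s0] := leP (successive_min d (cbody u (expR q))) 0.
    by rewrite ln0 // ln_ge0.
  by rewrite ler_ln ?posrE //; apply: successive_min_le HM.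
have K0 := lt_le_trans ltr01 K_ge1.
have p0 k : 0 < 2 ^+ k :> R by rewrite exprn_gt0.
have m0 : 0 < Num.max (2 ^+ a (i + d)) (expR q * (2 ^+ S i.+1)^-1) by rewrite lt_max p0.
rewrite /l lnM ?posrE ?mulr_gt0 // lnM ?posrE // lnXn // mulr_natl lerD2l.
case: (leP (2 ^+ a (i + d)) _) => _.
  by rewrite lnM ?posrE ?expR_gt0 ?invr_gt0 // expRK lnV ?posrE // lnXn // !mulr_natl le_max lexx orbT.
by rewrite lnXn // !mulr_natl le_max lexx.
Qed.

(** At Q = 2^T the point x_(i+k) enters the scaled body at about 2^(P k), and the P k sum to T, the
    exponent of Q. Exchanging a row k outside D in this optimal basis leaves 2^(P k) <= l up to
    constants, with P k >= a_(i+d). *)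
Lemma admissible_ge d i l (M : 'M[R]_(d, n.+1)) :
  (0 < d <= n)%N -> 0 < l ->
  min_admissible u (2 ^+ (S i + a (i + d))) l M ->
  2 ^+ a (i + d) <= (n.+1 * n.+1`!)%:R * (K * 2 ^+ (i + n)) ^+ n * l.
Proof.
move=> /andP[d0 dn] l0; set T := (S i + a (i + d))%N => HM.
set B := K * 2 ^+ (i + n).
have K0 : 0 < K := lt_le_trans ltr01 K_ge1.
have p0 k : 0 < 2 ^+ k :> R by rewrite exprn_gt0.
have B0 : 0 < B by rewrite mulr_gt0.
(* For x_i the product with u dominates, of size 2^(T - S_i) = 2^(a_(i+d)) after scaling; for the
   other points the norm does. *)
pose P k := if k == 0%N then a (i + d) else a (i + k).
have PT (k : 'I_n.+1) : (T <= S (i + k) + P k)%N.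
  case: k => -[|k] kn /=; first by rewrite addn0.
  rewrite /P /=; apply: (@leq_trans (S i.+1 + a i.+1)).
    by rewrite window_shift // leq_add2l a_leq //; lia.
  by apply: leq_add; [apply: window_leq|apply: a_leq]; lia.
have aP (k : 'I_n.+1) : (a (i + k) <= P k)%N.
  by rewrite /P; case: eqP => // ->; apply: a_leq; lia.
(* These d - 1 indices are the ones where P k may fall below a_(i+d). *)
pose D := [set k : 'I_n.+1 | 0 < k < d]%N.
have cD : (#|D| < d)%N.
  have -> : D = ((fun k : 'I_d.-1 => inord k.+1 : 'I_n.+1) @: 'I_d.-1)%SET.
    apply/setP => k; rewrite inE; apply/idP/imsetP => [kd|[j _ ->]].
      have kd' : (k.-1 < d.-1)%N by lia.
      exists (Ordinal kd') => //; apply/val_inj; rewrite /= inordK; first by lia.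
      by have := ltn_ord k; lia.
    by rewrite inordK; have := ltn_ord j; lia.
  by apply: leq_ltn_trans (leq_imset_card _ _) _; rewrite card_ord; lia.
have := @exchange_le R n.+1 d u (2 ^+ T)^-1 l M (block R n a i) D (fun k => B * 2 ^+ P k) u1.
rewrite invrK => /(_ (block_unit R a n_gt0 i)) exch.
have [||//|//|k kD] := exch.
- by move=> p q; rewrite mxE point_int.
- move=> k; rewrite rowK; have kn := ltn_ord k; split.
    apply: le_trans (norm2_point _) _; rewrite /B -mulrA ler_wpM2l ?(ltW K0) //.
    by rewrite -exprD ler_eXn2l ?ltr1n // leq_add ?aP //; lia.
  apply: le_trans (dotprod_point _) _.
  rewrite /B -(mulrA K) mulrCA ler_wpM2l ?(ltW K0) //.
  apply: (@le_trans _ _ (2 ^- T * 2 ^+ P k)); last first.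
    by rewrite [leRHS]mulrCA ler_peMl ?exprn_ege1 ?ler1n //.
  rewrite ler_pdivlMl // ler_pdivrMr // -exprD ler_eXn2l ?ltr1n //.
  by rewrite addnC PT.
have Pk : (a (i + d) <= P k)%N.
  move: kD; rewrite inE /P; case: eqP => [//|k0 kd]; apply: a_leq; lia.
rewrite big_split /= prodr_const prodrXr cardC1 card_ord /=.
set s := (\sum_(_ | _) _)%N => H1.
have sT : (s + P k = T)%N.
  have <- : (\sum_(j < n.+1) P j = s + P k)%N by rewrite (bigD1 k) //= addnC.
  by rewrite big_ord_recl /= /T addnC; congr (_ + _)%N; apply: eq_bigr.
apply: (@le_trans _ _ (2 ^+ P k)); first by rewrite ler_eXn2l ?ltr1n.
have -> : 2 ^+ P k = 2 ^+ T * (2 ^+ s)^-1 :> R by rewrite -sT exprD mulrAC mulfV ?mul1r ?gt_eqF.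
rewrite ler_pdivrMr // -[leLHS]mulr1.
apply: le_trans (ler_wpM2l (ltW (p0 T)) H1) _.
rewrite le_eqVlt; apply/orP; left; apply/eqP.
have : (2 ^+ T : R) != 0 by rewrite gt_eqF.
move: (2 ^+ T : R) (2 ^+ s : R) (B ^+ n) ((n.+1 * n.+1`!)%:R : R) => t y b c t0.
by field.
Qed.

Lemma Lmap_ge d i : (0 < d <= n)%N ->
  (a (i + d))%:R * ln 2 <=
  Lmap u d ((S i + a (i + d))%:R * ln 2) +
    (ln (n.+1 * n.+1`!)%:R + n%:R * (ln K + (i + n)%:R * ln 2)).
Proof.
move=> dn; set T := (S i + a (i + d))%N.
have K0 : 0 < K := lt_le_trans ltr01 K_ge1.
have p0 k : 0 < 2 ^+ k :> R by rewrite exprn_gt0.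
have qT : expR (T%:R * ln 2) = 2 ^+ T :> R by rewrite expRM_natl lnK ?posrE.
have c0 : 0 < (n.+1 * n.+1`!)%:R :> R by rewrite ltr0n muln_gt0 fact_gt0.
have B0 : 0 < (n.+1 * n.+1`!)%:R * (K * 2 ^+ (i + n)) ^+ n :> R.
  by rewrite mulr_gt0 // exprn_gt0 // mulr_gt0.
have le_s : 2 ^+ a (i + d) / ((n.+1 * n.+1`!)%:R * (K * 2 ^+ (i + n)) ^+ n)
    <= successive_min d (cbody u (expR (T%:R * ln 2))).
  have [M HM] := points_admissible i (T%:R * ln 2) (proj2 (andP dn)).
  apply: successive_min_ge HM _.
    by rewrite !mulr_gt0 // lt_max p0.
  move=> l N l0; rewrite qT => HN.
  by rewrite ler_pdivrMr // mulrC; apply: admissible_ge HN.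
have := le_s; rewrite -ler_ln ?posrE; last 2 first.
- by rewrite divr_gt0.
- by apply: lt_le_trans le_s; rewrite divr_gt0.
rewrite -/(Lmap u d _) ln_div ?posrE // lnM ?posrE ?exprn_gt0 ?mulr_gt0 //.
rewrite !lnXn ?mulr_gt0 // lnM ?posrE // lnXn // -!(mulr_natl (ln _)) -(mulr_natl (_ + _)).
by rewrite lerBlDr.
Qed.

(** In units of [ln 2], between T_i and T_(i+1) the bound of [Lmap_le] is first the constant
    a_(i+d), then rises with slope 1, so its ratio to q peaks at the points T_i. There [Lmap_ge]
    matches it; the errors are linear in i, negligible by [linear_small]. *)
Lemma phi_barE d (phi : R) : (0 < d <= n)%N -> 0 <= phi <= 1 ->
  (forall i, (a (i + d))%:R <= phi * (S i + a (i + d))%:R) ->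
  (forall N, exists2 i, (N <= i)%N & (a (i + d))%:R = phi * (S i + a (i + d))%:R) ->
  phi_bar d u = phi.
Proof.
move=> dn /andP[phi0 phi1] phi_ge phi_eq.
have l2 : 0 < ln 2 :> R by rewrite ln_gt0 // ltr1n.
have lK : 0 <= ln K by rewrite ln_ge0 // K_ge1.
pose T i := (S i + a (i + d))%N.
have aT i : (a i <= T i)%N by apply: leq_trans (leq_addl _ _); apply: a_leq; lia.
have T_large (q : R) : exists N, forall i, (N <= i)%N -> q < (T i)%:R * ln 2.
  have [N aN] := a_superlinear 1; exists (maxn N (Num.truncn (q / ln 2)).+1) => i.
  rewrite geq_max => /andP[Ni qi]; rewrite -ltr_pdivrMr //.
  apply: lt_le_trans (truncnS_gt _) _; rewrite ler_nat.
  apply: leq_trans qi (leq_trans _ (aT i)).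
  by rewrite -[leqLHS]mul1n aN.
rewrite /phi_bar (@limf_esup_pinfty_eq _ _ phi) // => e.
  move=> e0; pose C := ln K + d.+1%:R * ln 2.
  have [N CN] := linear_small C (mulr_gt0 e0 l2).
  (* Adding 1 makes q positive and excludes j = 0 below, so that T_i [ln 2] <= q < T_(i+1) [ln 2]
     for some i >= N. *)
  exists ((T N)%:R * ln 2 + 1) => q qN.
  have q0 : 0 < q.
    by apply: lt_le_trans qN; rewrite ltr_wpDl ?ltr01 // mulr_ge0 // ltW.
  have [N' TN'] := T_large q.
  have ex : exists j, q < (T (N + j)%N)%:R * ln 2 by exists N'; apply: TN'; lia.
  case: (ex_minnP ex) => [[|j] jlt jmin].
    by move: jlt; rewrite addn0 => /(le_lt_trans qN); rewrite gtrDl ltr10.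
  have jle : (T (N + j)%N)%:R * ln 2 <= q.
    by rewrite leNgt; apply/negP => /jmin; rewrite ltnn.
  move: (N + j)%N (leq_addr j N) (addnS N j) jle jlt {jmin} => i Ni -> ile ilt.
  rewrite ler_pdivrMr // mulrDl addrC.
  apply: le_trans (Lmap_le i q (proj2 (andP dn))) _; apply: lerD.
    apply: (@le_trans _ _ (C * i.+1%:R)).
      rewrite /C mulrDl lerD ?ler_peMr ?ler1n // mulrAC (ler_wpM2r (ltW l2)) //.
      by rewrite -natrM ler_nat; nia.
    apply: le_trans (CN i Ni) _; rewrite -mulrA (ler_wpM2l (ltW e0)) //.
    apply: le_trans ile; rewrite mulrC (ler_wpM2r (ltW l2)) // ler_nat; exact: aT.
  rewrite ge_max; apply/andP; split.
    apply: (@le_trans _ _ (phi * (T i)%:R * ln 2)); first by rewrite (ler_wpM2r (ltW l2)).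
    by rewrite -mulrA ler_wpM2l.
  have := phi_ge i.+1; move: ilt; rewrite /T natrD.
  move: (S i.+1)%:R (a (i.+1 + d))%:R => s t ilt tle.
  have qE : q = q / ln 2 * ln 2 by rewrite divfK ?gt_eqF.
  move: (q / ln 2) qE ilt => y ->.
  rewrite ltr_pM2r // -mulrBl mulrA ler_pM2r // => yst.
  (* The bound y - s has slope 1 >= phi, so comparing it with phi * y at the right end y = s + t
     suffices. *)
  have : (y - s) * (1 - phi) <= t * (1 - phi).
    by rewrite ler_wpM2r ?subr_ge0 // lerBlDr addrC ltW.
  by lra.
move=> q0 e0; pose C := ln (n.+1 * n.+1`!)%:R + n%:R * (ln K + n.+1%:R * ln 2) : R.
have [N CN] := linear_small C (mulr_gt0 e0 l2).
have [N' TN'] := T_large (Num.max 0 q0).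
have [i Ni ai] := phi_eq (maxn N N').
have := TN' i (leq_trans (leq_maxr _ _) Ni); rewrite gt_max => /andP[T0 Tq0].
exists ((T i)%:R * ln 2); first exact: ltW.
rewrite -(ler_pM2r T0) mulrDl divfK ?gt_eqF // mulrA -ai.
apply: le_trans (Lmap_ge i dn) _; rewrite lerD2l.
apply: (@le_trans _ _ (C * i.+1%:R)).
  rewrite /C mulrDl lerD ?ler_peMr ?ler1n //.
    by rewrite ln_ge0 // ler1n muln_gt0 fact_gt0.
  rewrite -mulrA ler_wpM2l // mulrDl lerD ?ler_peMr ?ler1n // mulrAC (ler_wpM2r (ltW l2)) //.
  by rewrite -natrM ler_nat; nia.
apply: le_trans (CN i (leq_trans (leq_maxl _ _) Ni)) _.
rewrite -mulrA (ler_wpM2l (ltW e0)) // mulrC (ler_wpM2r (ltW l2)) // ler_nat; exact: aT.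
Qed.

End Exponent.

(** * Realising the exponents and avoiding the zeros of a polynomial *)

(** The d-th exponent as a function of s = r_d, for n = m + 1 and d = c + 1. *)
Definition exponent_value (R : realType) (m c s : nat) : R :=
  if c is 0 then (m.+1 + s)%:R^-1 else s%:R / ((m - c).+2 * s + c)%:R.

Lemma exponent_value_inj (R : realType) m c : injective (exponent_value R m c).
Proof.
case: c => [|c] s t /=.
  by move=> /invr_inj/eqP; rewrite eqr_nat eqn_add2l => /eqP.
move=> /eqP; rewrite eqr_div ?pnatr_eq0 -?lt0n ?addn_gt0 ?orbT //.
(* After cross-multiplication the terms in s * t cancel, leaving a nonzero multiple of s = t. *)
by rewrite -!natrM eqr_nat => /eqP; nia.
Qed.

Lemma exponent_value_bounds (R : realType) m c s : 0 <= exponent_value R m c s <= 1.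
Proof.
case: c => [|c] /=; first by rewrite invr_ge0 ler0n invf_le1 ?ltr0n // ler1n.
by rewrite divr_ge0 // ler_pdivrMr ?mul1r ?ltr0n ?ler_nat ?addn_gt0 ?orbT //; nia.
Qed.

Lemma phi_bar_exists (R : realType) (m : nat) (r : nat -> nat) :
  (0 < m)%N -> (2 <= r 0)%N -> (forall i, (i < m)%N -> (i.+1 * r i <= r i.+1)%N) ->
  exists2 u : 'rV[R]_m.+2, norm2 u = 1 &
  forall c, (c <= m)%N -> phi_bar c.+1 u = exponent_value R m c (r c).
Proof.
move=> m_gt0 r0 rS; have a_leq := height_leq m_gt0 r0 rS.
have [u u1 u_ge0] := @exists_nonneg R m.+1 (height m r) isT.
exists u => // c cm; apply: (@phi_barE R m.+1 (height m r) isT a_leq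
  (height_superlinear m_gt0 r0 rS) u u1 u_ge0 c.+1).
- by [].
- exact: exponent_value_bounds.
- move=> i; case: c cm => [|c] cm /=.
    rewrite ler_pdivlMl ?ltr0n // -natrM ler_nat addn1.
    by rewrite addSn mulSn [leqRHS]addnC leq_add2l window0_ge.
  rewrite mulrAC ler_pdivlMr ?ltr0n ?addn_gt0 ?orbT // -!natrM ler_nat.
  have := @window_ge m r m_gt0 r0 rS c.+1 i cm.
  move: (height _ _ _) (\sum_(_ < _) _)%N (r _) (m - _)%N => A s t k; nia.
- move=> N; case: c cm => [|c] cm /=.
    have [i Ni ei] := window0_eq m_gt0 r0 N; exists i => //.
    apply: (canRL (mulKf _)); first by rewrite pnatr_eq0.
    by rewrite -natrM addn1 addSn mulSn ei addnC.
  have [i Ni ei] := window_eq m_gt0 r0 (c := c.+1) N cm; exists i => //.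
  rewrite mulrAC; apply: (canRL (mulfK _)); first by rewrite pnatr_eq0 -lt0n addn_gt0 orbT.
  rewrite -!natrM; congr _%:R; move: ei.
  move: (height _ _ _) (\sum_(_ < _) _)%N (r _) (m - _)%N => A s t k; nia.
Qed.

(* The variable of index [i : 'I_n] (counted from 0) stands for X_(i+1). *)
Theorem theorem6 (R : realType) (n : nat) (hn : (3 <= n)%N) :
  ~ exists P : mpoly.mpoly n R,
      P != 0 /\
      forall u : 'rV[R]_n.+1, norm2 u = 1 ->
        mpoly.meval (fun i : 'I_n => phi_bar i.+1 u) P = 0.
Proof.
case: n hn => // m; rewrite ltnS => m2 [P [P0 Pu]]; have m_gt0 := ltnW m2.
(* The bounds 2 and [i.+1 * s] are exactly what [phi_bar_exists] asks of the ratios. *)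
have [r [r0 rS]] := meval_neq0_exists 2 (fun i s => i.+1 * s)%N
  (@exponent_value_inj R m) P0.
have [u u1 phiu] := @phi_bar_exists R m r m_gt0 (r0 isT) rS.
rewrite -(Pu u u1) => /eqP; apply; apply: mpoly.meval_eq => i /=.
by rewrite phiu // -ltnS.
Qed.
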